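(* For each $p>0$, $$\mathbb{L}^p_b=\Big\{X\in\mathbb{L}^p:\lim_{n\to\infty}\mathbb{E}\big[|X|^p\mathbf{1}_{\{|X|>n\}}\big]=0\Big\}.$$
   Context: $\Omega$ is a complete separable metric space with Borel $\sigma$-algebra $\mathscr{B}(\Omega)$, and $\mathscr{P}$ is a given nonempty set of probability measures on $(\Omega,\mathscr{B}(\Omega))$. $L^0(\Omega)$ is the space of real Borel functions on $\Omega$, and $B_b(\Omega)$ the bounded ones. For $A\in\mathscr{B}(\Omega)$, $c(A):=\sup_{P\in\mathscr{P}}P(A)$. A Borel set $A$ is polar if $c(A)=0$, and a property holds quasi-surely (q.s.) if it holds outside a polar set. For $X\in L^0(\Omega)$ such that $E_P[X]$ exists for each $P\in\mathscr{P}$, $\mathbb{E}[X]:=\sup_{P\in\mathscr{P}}E_P[X]$. For $p>0$, $\mathcal{L}^p=\{X\in L^0(\Omega):\mathbb{E}[|X|^p]<\infty\}$, $\mathcal{N}=\{X\in L^0(\Omega):X=0\text{ q.s.}\}$, $\mathbb{L}^p=\mathcal{L}^p/\mathcal{N}$ (classes are not distinguished from representatives). $\mathbb{L}^p$ is a Banach space under $\|X\|_p=(\mathbb{E}[|X|^p])^{1/p}$ if $p\ge1$, and a complete metric space under $d(X,Y)=\mathbb{E}[|X-Y|^p]$ if $p<1$. $\mathbb{L}^p_b$ is the completion of $B_b(\Omega)$ with respect to this distance, i.e. the closure in $\mathbb{L}^p$ of (the image of) $B_b(\Omega)$. *)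

(* Defs.v *)
From HB Require Import structures.
From mathcomp Require Import all_boot all_order all_algebra generic_quotient.
From mathcomp Require Import all_classical all_reals all_analysis.
From mathcomp Require Import measurable_realfun.

Set Implicit Arguments.
Unset Strict Implicit.
Unset Printing Implicit Defensive.

Import Order.TTheory GRing.Theory Num.Def Num.Theory.
Import numFieldNormedType.Exports.

Local Open Scope classical_set_scope.
Local Open Scope ring_scope.

(* Pointedness, required of measurable types, excludes only the empty space,
   which carries no probability measure. *)
#[short(type="completeMetricType")]
HB.structure Definition CompleteMetric (K : numDomainType) :=
  {M of Metric K M & Complete M & Pointed M}.

Definition separable (T : topologicalType) :=
  exists2 S : set T, countable S & dense S.

Notation borel T := (g_sigma_algebraType (@open T)).

Section upper_expectation.
Context d (T : measurableType d) (R : realType).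
Variable PP : set (probability T R).
Local Open Scope ereal_scope.

Definition upper_expectation (X : T -> R) : \bar R :=
  ereal_sup [set 'E_P[X] | P in PP].

Definition capacity (A : set T) : \bar R := ereal_sup [set P A | P in PP].

(* [almost_everywhere] accepts an arbitrary set function; applied to the
   capacity it reads: the complement of Q is included in a measurable A such
   that capacity A = 0, i.e. in a polar set. *)
Definition quasi_surely (Q : set T) : Prop := almost_everywhere capacity Q.

Definition moment (p : R) (X : T -> R) : \bar R :=
  upper_expectation (fun w => `|X w| `^ p)%R.

(* The p-norm if 1 <= p, and the p-th moment, whose subadditivity yields the
   distance of Lp, if p < 1; only meaningful on functions with finite moment. *)
Definition size_p (p : R) (X : T -> R) : R :=
  if (1 <= p)%R then (fine (moment p X) `^ p^-1)%R else fine (moment p X).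

End upper_expectation.

Section upper_expectation_theory.
Context d (T : measurableType d) (R : realType).
Variable PP : set (probability T R).
Hypothesis PP0 : PP !=set0.
Local Open Scope ereal_scope.

Lemma upper_expectation_ge0 (X : T -> R) :
  (forall w, 0 <= X w)%R -> 0 <= upper_expectation PP X.
Proof.
move=> X0; have [P PPP] := PP0.
apply: (@le_trans _ _ 'E_P[X]).
  by rewrite unlock; apply: integral_ge0 => x _; rewrite lee_fin.
by apply: ereal_sup_ubound; exists P.
Qed.

Lemma capacity_ge0 A : 0 <= capacity PP A.
Proof.
have [P PPP] := PP0; apply: (@le_trans _ _ (P A)) => //.
by apply: ereal_sup_ubound; exists P.
Qed.

Lemma capacity_eq0P A :
  capacity PP A = 0 <-> forall P, PP P -> P A = 0.
Proof.
split=> [cA P PPP|PA].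
  apply/eqP; rewrite eq_le measure_ge0 andbT -cA.
  by apply: ereal_sup_ubound; exists P.
apply/eqP; rewrite eq_le capacity_ge0 andbT.
by apply: ge_ereal_sup => _ [P PPP <-]; rewrite PA.
Qed.

Lemma quasi_surelyT (Q : set T) : (forall w, Q w) -> quasi_surely PP Q.
Proof.
move=> QT; exists set0; split => //.
- by apply/capacity_eq0P => P _; rewrite measure0.
- by move=> w /= /(_ (QT w)).
Qed.

Lemma quasi_surely2 (Q1 Q2 Q : set T) : (forall w, Q1 w -> Q2 w -> Q w) ->
  quasi_surely PP Q1 -> quasi_surely PP Q2 -> quasi_surely PP Q.
Proof.
move=> QQ [A [mA /capacity_eq0P A0 QA]] [B [mB /capacity_eq0P B0 QB]].
exists (A `|` B); split; first exact: measurableU.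
  apply/capacity_eq0P => P PPP; have AP := A0 P PPP; have BP := B0 P PPP.
  by apply/eqP; rewrite -measure_le0 -[leRHS]adde0 -{1}AP -BP measureU2.
move=> w /= nQ; have [q1|q1] := pselect (Q1 w); last by left; exact: QA.
by right; apply: QB => /= q2; apply: nQ; exact: QQ.
Qed.

Lemma eq_upper_expectation (X Y : T -> R) :
  measurable_fun setT X -> measurable_fun setT Y ->
  quasi_surely PP [set w | X w = Y w] ->
  upper_expectation PP X = upper_expectation PP Y.
Proof.
move=> mX mY [A [mA /capacity_eq0P A0 XYA]]; congr ereal_sup.
apply: eq_imagel => P PPP; rewrite unlock.
apply: ae_eq_integral => //; [exact/measurable_EFinP..|].
exists A; split => //; first exact: A0.
by move=> w /= nXY; apply: XYA => /= XY; apply: nXY => _; rewrite XY.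
Qed.

Variable p : R.
Hypothesis p0 : (0 < p)%R.

Lemma measurable_absp (X : T -> R) : measurable_fun setT X ->
  measurable_fun setT (fun w => `|X w| `^ p)%R.
Proof.
move=> mX; apply: (@measurableT_comp _ _ _ _ _ _ (@powR R ^~ p)) => //.
exact: measurableT_comp.
Qed.

Lemma moment_ge0 X : 0 <= moment PP p X.
Proof. by apply: upper_expectation_ge0 => w; exact: powR_ge0. Qed.

Lemma moment_fineK X : moment PP p X < +oo ->
  moment PP p X = (fine (moment PP p X))%:E.
Proof. by move=> Xoo; rewrite fineK// ge0_fin_numE// moment_ge0. Qed.

Lemma eq_moment X Y : measurable_fun setT X -> measurable_fun setT Y ->
  quasi_surely PP [set w | X w = Y w] -> moment PP p X = moment PP p Y.
Proof.
move=> mX mY XY; apply: eq_upper_expectation; [exact: measurable_absp..|].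
by apply: (quasi_surely2 _ XY XY) => w /= ->.
Qed.

Lemma moment0 : moment PP p (cst 0%R) = 0.
Proof.
rewrite /moment /upper_expectation; have [P PPP] := PP0.
rewrite (_ : [set _ | _ in _] = [set 0]) ?ereal_sup1//.
have e Q : 'E_Q[(fun w : T => `|cst 0 w| `^ p)%R] = 0 :> \bar R.
  by rewrite unlock integral0_eq// => w _; rewrite normr0 powR0 ?gt_eqF.
by apply/seteqP; split => [_ [Q _ <-]/=|_ ->]; [exact: e|exists P].
Qed.

Lemma moment_eq0 X : measurable_fun setT X -> moment PP p X = 0 ->
  quasi_surely PP [set w | X w = 0%R].
Proof.
move=> mX X0; exists (X @^-1` [set~ 0%R]); split.
- by rewrite -[X in measurable X]setTI; apply: mX => //; exact: measurableC.
- apply/capacity_eq0P => P PPP.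
  have EP0 : \int[P]_w (`|X w| `^ p)%:E = 0.
    apply/eqP; rewrite eq_le; apply/andP; split; last first.
      by apply: integral_ge0 => w _; rewrite lee_fin powR_ge0.
    by rewrite -X0; apply: ereal_sup_ubound; exists P => //; rewrite unlock.
  have : ae_eq P setT (fun w => (`|X w| `^ p)%:E) (cst 0).
    apply/ae_eq_integral_abs => //.
      by apply/measurable_EFinP; exact: measurable_absp.
    rewrite -EP0; apply: eq_integral => w _.
    by rewrite gee0_abs// lee_fin powR_ge0.
  move=> [A [mA PA XA]]; apply: (subset_measure0 _ mA _ PA).
    by rewrite -[X in measurable X]setTI; apply: mX => //; exact: measurableC.
  move=> w /= Xw; apply: XA => /= /(_ Logic.I) [/powR_eq0_eq0/normr0_eq0].
  exact: Xw.
- by move=> w /=.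
Qed.

Lemma size_p_ge0 X : (0 <= size_p PP p X)%R.
Proof.
by rewrite /size_p; case: ifP => _; [exact: powR_ge0|exact/fine_ge0/moment_ge0].
Qed.

Lemma powR_subadd (a b : R) : (p <= 1 -> 0 <= a -> 0 <= b ->
  (a + b) `^ p <= a `^ p + b `^ p)%R.
Proof.
move=> p1 a0 b0; have [ab0|ab0] := eqVneq (a + b)%R 0%R.
  by rewrite ab0 powR0 ?gt_eqF// addr_ge0 ?powR_ge0.
have ab : (0 < a + b)%R by rewrite lt0r ab0 addr_ge0.
have key (c : R) : (0 <= c -> c <= a + b ->
    c / (a + b) * (a + b) `^ p <= c `^ p)%R.
  move=> c0 cab; have [->|cN0] := eqVneq c 0%R.
    by rewrite !mul0r powR_ge0.
  have -> : (c `^ p = (c / (a + b)) `^ p * (a + b) `^ p)%R.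
    by rewrite -powRM ?divr_ge0 ?(ltW ab)// divfK.
  apply: ler_wpM2r; first exact: powR_ge0.
  rewrite -[leLHS]powRr1 ?divr_ge0 ?(ltW ab)//.
  have c_gt0 : (0 < c)%R by rewrite lt0r cN0.
  by apply: ger_powR => //; rewrite divr_gt0//= ler_pdivrMr// mul1r.
have := lerD (key a a0 _) (key b b0 _).
by rewrite -mulrDl -mulrDl divff// mul1r; apply; rewrite ?lerDl ?lerDr.
Qed.

Lemma momentD X Y : measurable_fun setT X -> measurable_fun setT Y ->
  moment PP p X < +oo -> moment PP p Y < +oo ->
  moment PP p (X \+ Y)%R <=
    (if (1 <= p)%R then (size_p PP p X + size_p PP p Y) `^ p
     else size_p PP p X + size_p PP p Y)%:E.
Proof.
move=> mX mY Xoo Yoo; apply: ge_ereal_sup => _ [P PPP <-].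
have le_moment Z : \int[P]_w (`|Z w| `^ p)%:E <= moment PP p Z.
  by apply: ereal_sup_ubound; exists P => //; rewrite unlock.
have int_ge0 (Z : T -> R) : 0 <= \int[P]_w (`|Z w| `^ p)%:E.
  by apply: integral_ge0 => w _; rewrite lee_fin powR_ge0.
rewrite unlock /size_p; case: (boolP (1 <= p)%R) => p1.
  have LnormE (Z : T -> R) :
      'N[P]_p%:E[EFin \o Z] = (\int[P]_w (`|Z w| `^ p)%:E) `^ p^-1.
    by rewrite unlock.
  have le_Lnorm Z : moment PP p Z < +oo ->
      'N[P]_p%:E[EFin \o Z] <= (fine (moment PP p Z) `^ p^-1)%:E.
    move=> Zoo; rewrite LnormE -poweR_EFin -moment_fineK//.
    by rewrite gt0_ler_poweR ?in_itv/= ?leey ?andbT ?moment_ge0// invr_ge0 ltW.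
  have := minkowski_EFin P mX mY p1.
  move=> /le_trans/(_ (leeD (le_Lnorm _ Xoo) (le_Lnorm _ Yoo))).
  rewrite LnormE -EFinD => h.
  have intE : \int[P]_w (`|(X \+ Y)%R w| `^ p)%:E =
      ((\int[P]_w (`|(X \+ Y)%R w| `^ p)%:E) `^ p^-1) `^ p.
    by rewrite -poweRrM mulVf ?gt_eqF// poweRe1// int_ge0.
  rewrite intE -poweR_EFin.
  apply: gt0_ler_poweR h; rewrite ?in_itv/= ?leey ?andbT ?poweR_ge0//.
    exact: ltW.
  by rewrite lee_fin addr_ge0 ?powR_ge0.
have ple1 : (p <= 1)%R by move: p1; rewrite -ltNge => /ltW.
rewrite EFinD -!moment_fineK//.
apply: le_trans (leeD (le_moment X) (le_moment Y)).
have mE (Z : T -> R) : measurable_fun setT Z ->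
    measurable_fun setT (fun w => (`|Z w| `^ p)%:E).
  by move=> mZ; apply/measurable_EFinP; exact: measurable_absp.
rewrite -ge0_integralD//; [|exact: mE..].
apply: ge0_le_integral.
- by [].
- by move=> w _; rewrite lee_fin powR_ge0.
- by apply: mE; exact: measurable_funD.
- by apply: emeasurable_funD; exact: mE.
- move=> w _; rewrite -EFinD lee_fin.
  apply: le_trans (powR_subadd ple1 (normr_ge0 _) (normr_ge0 _)).
  by rewrite ge0_ler_powR ?nnegrE ?addr_ge0// ?ler_normD// ltW.
Qed.

Lemma momentD_lty X Y : measurable_fun setT X -> measurable_fun setT Y ->
  moment PP p X < +oo -> moment PP p Y < +oo -> moment PP p (X \+ Y)%R < +oo.
Proof.
by move=> mX mY Xoo Yoo; apply: le_lt_trans (momentD mX mY Xoo Yoo) (ltry _).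
Qed.

Lemma size_pD X Y : measurable_fun setT X -> measurable_fun setT Y ->
  moment PP p X < +oo -> moment PP p Y < +oo ->
  (size_p PP p (X \+ Y) <= size_p PP p X + size_p PP p Y)%R.
Proof.
move=> mX mY Xoo Yoo; have := momentD mX mY Xoo Yoo.
rewrite (moment_fineK (momentD_lty mX mY Xoo Yoo)) lee_fin.
set S := (size_p PP p X + size_p PP p Y)%R.
have S0 : (0 <= S)%R by rewrite addr_ge0 ?size_p_ge0.
rewrite /size_p; case: (boolP (1 <= p)%R) => // p1 h.
have -> : S = ((S `^ p) `^ p^-1)%R by rewrite -powRrM mulfV ?gt_eqF// powRr1.
apply: ge0_ler_powR h; rewrite ?nnegrE ?powR_ge0//; first by rewrite invr_ge0 ltW.
exact/fine_ge0/moment_ge0.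
Qed.

Lemma momentN X Y : moment PP p (X \- Y)%R = moment PP p (Y \- X)%R.
Proof. by congr upper_expectation; apply/funext => w; rewrite /= distrC. Qed.

Lemma size_pB X Y : size_p PP p (X \- Y)%R = size_p PP p (Y \- X)%R.
Proof. by rewrite /size_p momentN. Qed.

Lemma momentB_lty X Y : measurable_fun setT X -> measurable_fun setT Y ->
  moment PP p X < +oo -> moment PP p Y < +oo -> moment PP p (X \- Y)%R < +oo.
Proof.
move=> mX mY Xoo Yoo; apply: (@momentD_lty X (\- Y)%R) => //.
  exact: measurableT_comp.
rewrite (_ : moment _ _ _ = moment PP p Y)//.
by congr upper_expectation; apply/funext => w; rewrite /= normrN.
Qed.

Lemma eq_size_p X Y : measurable_fun setT X -> measurable_fun setT Y ->
  quasi_surely PP [set w | X w = Y w] -> size_p PP p X = size_p PP p Y.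
Proof. by move=> mX mY XY; rewrite /size_p (eq_moment mX mY XY). Qed.

Lemma size_p_eq0 X : measurable_fun setT X -> moment PP p X < +oo ->
  size_p PP p X = 0%R -> quasi_surely PP [set w | X w = 0%R].
Proof.
move=> mX Xoo X0; apply: moment_eq0 => //; rewrite moment_fineK//; congr EFin.
by move: X0; rewrite /size_p; case: ifP => // _ /powR_eq0_eq0.
Qed.

Lemma moment_bounded_fun (X : {mfun T >-> R}) :
  bounded_fun X -> moment PP p X < +oo.
Proof.
move=> [M [Mreal /(_ (`|M| + 1)%R)]].
rewrite (le_lt_trans (ler_norm _)) ?ltrDl// => /(_ erefl) XM.
apply: (@le_lt_trans _ _ ((`|M| + 1) `^ p)%:E); last exact: ltry.
apply: ge_ereal_sup => _ [P PPP <-]; rewrite unlock.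
apply: (@le_trans _ _ (\int[P]_w (cst ((`|M| + 1) `^ p)%:E w))).
  apply: ge0_le_integral.
  - by [].
  - by move=> w _; rewrite lee_fin powR_ge0.
  - by apply/measurable_EFinP; apply: measurable_absp; exact: measurable_funPT.
  - exact: measurable_cst.
  - move=> w _; rewrite lee_fin ge0_ler_powR ?nnegrE ?addr_ge0//; first exact: ltW.
    exact: XM.
by rewrite integral_cst//= probability_setT mule1.
Qed.

End upper_expectation_theory.

Section Lp_space.
Context d (T : measurableType d) (R : realType).
Variables (PP : set (probability T R)) (PP0 : PP !=set0).
Variables (p : R) (p0 : 0 < p).

Definition preLp := {X : {mfun T >-> R} | (moment PP p X < +oo)%E}.

Definition mfun_of_preLp (X : preLp) : {mfun T >-> R} := val X.
Local Coercion mfun_of_preLp : preLp >-> MeasurableFun.type.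

Lemma measurable_preLp (X : preLp) : measurable_fun setT X.
Proof. exact: measurable_funPT. Qed.

Lemma moment_preLp (X : preLp) : (moment PP p X < +oo)%E.
Proof. exact: (valP X). Qed.

(* The unused proofs make the relation, hence the quotient, determine the
   hypotheses under which it is an equivalence and Lp a metric space. *)
Definition qs_eq (_ : PP !=set0) (_ : 0 < p) (X Y : preLp) : bool :=
  `[< quasi_surely PP [set w | X w = Y w] >].

Let qs_eq_refl : reflexive (qs_eq PP0 p0).
Proof. by move=> X; apply/asboolP; exact: quasi_surelyT. Qed.

Let qs_eq_sym : symmetric (qs_eq PP0 p0).
Proof.
by move=> X Y; apply/asboolP/asboolP => h;
  apply: (quasi_surely2 PP0 _ h h) => w /=.
Qed.

Let qs_eq_trans : transitive (qs_eq PP0 p0).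
Proof.
move=> Y X Z /asboolP h /asboolP k; apply/asboolP.
by apply: (quasi_surely2 PP0 _ h k) => w /= -> ->.
Qed.

Canonical qs_eq_equiv := EquivRel (qs_eq PP0 p0) qs_eq_refl qs_eq_sym qs_eq_trans.

Local Open Scope quotient_scope.

Definition Lp : Type := {eq_quot qs_eq PP0 p0}.
HB.instance Definition _ := Choice.on Lp.
HB.instance Definition _ := EqQuotient.on Lp.

Definition mfun_of_Lp (X : Lp) : {mfun T >-> R} := mfun_of_preLp (repr X).
Coercion mfun_of_Lp : Lp >-> MeasurableFun.type.

Lemma qs_eq_reprpi (X : preLp) :
  quasi_surely PP [set w | (\pi_Lp X : Lp) w = X w].
Proof.
have /eqmodP/asboolP// : (repr (\pi_Lp X) = X %[mod Lp]) by rewrite reprK.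
Qed.

Lemma Lp_eqP (X Y : Lp) : X = Y <-> quasi_surely PP [set w | X w = Y w].
Proof.
split=> [->|XY]; first exact: quasi_surelyT.
by rewrite -[X]reprK -[Y]reprK; apply/eqmodP/asboolP.
Qed.

Definition Lp_dist (X Y : Lp) : R := size_p PP p (fun w => X w - Y w).

Let Lp_measurable (X : Lp) : measurable_fun setT X.
Proof. exact: measurable_funPT. Qed.

Let Lp_measurableB (X Y : Lp) : measurable_fun setT (X \- Y).
Proof. exact: measurable_funB. Qed.

Lemma moment_Lp (X : Lp) : (moment PP p X < +oo)%E.
Proof. exact: moment_preLp. Qed.

Let moment_LpB (X Y : Lp) : (moment PP p (X \- Y)%R < +oo)%E.
Proof. by apply: momentB_lty => //; exact: moment_Lp. Qed.

Lemma Lp_dist_pi (X Y : preLp) :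
  Lp_dist (\pi_Lp X) (\pi_Lp Y) = size_p PP p (fun w => X w - Y w).
Proof.
apply: eq_size_p => //; first exact: Lp_measurableB.
  by apply: measurable_funB; exact: measurable_preLp.
by apply: (quasi_surely2 PP0 _ (qs_eq_reprpi X) (qs_eq_reprpi Y)) => w /= -> ->.
Qed.

Let Lp_distxx X : Lp_dist X X = 0.
Proof.
rewrite /Lp_dist (_ : (fun _ => _) = cst 0); last first.
  by apply/funext => w; rewrite /= subrr.
by rewrite /size_p moment0//= powR0 ?if_same// invr_eq0 gt_eqF.
Qed.

Let Lp_dist_positivity X Y : Lp_dist X Y = 0 -> X = Y.
Proof.
move=> XY; apply/Lp_eqP.
have h := size_p_eq0 PP0 (Lp_measurableB X Y) (moment_LpB X Y) XY.
by apply: (quasi_surely2 PP0 _ h h) => w /= /eqP; rewrite subr_eq0 => /eqP.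
Qed.

Let Lp_dist_sym X Y : Lp_dist X Y = Lp_dist Y X.
Proof. exact: size_pB. Qed.

Let Lp_dist_triangle Y X Z : Lp_dist X Z <= Lp_dist X Y + Lp_dist Y Z.
Proof.
have := size_pD PP0 p0 (Lp_measurableB X Y) (Lp_measurableB Y Z)
  (moment_LpB X Y) (moment_LpB Y Z).
congr (_ <= _); congr size_p; apply/funext => w /=.
by rewrite addrA subrK.
Qed.

HB.instance Definition _ := isMetric.Build R Lp
  Lp_distxx Lp_dist_positivity Lp_dist_sym Lp_dist_triangle.

(* By [moment_bounded_fun], every bounded measurable function is in preLp, so
   this is the image in Lp of all bounded measurable functions. *)
Definition Bb : set Lp :=
  [set \pi_Lp X | X in [set X : preLp | bounded_fun X]].

Definition Lpb : set Lp := closure Bb.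

Lemma LpbP (X : Lp) :
  Lpb X <-> forall e, 0 < e -> exists2 Y, Bb Y & Lp_dist X Y < e.
Proof.
split=> [BX e e0|BX U /nbhs_ballP[e /= e0 eU]].
  have [Y [BY]] := BX _ (nbhsx_ballx X _ e0).
  by rewrite ballEmdist => XY; exists Y.
have [Y BY XY] := BX _ e0.
by exists Y; split => //; apply: eU; rewrite ballEmdist.
Qed.

End Lp_space.

Arguments Lp {d T R PP} PP0 {p} p0.
Arguments Bb {d T R PP} PP0 {p} p0.
Arguments Lpb {d T R PP} PP0 {p} p0.

(* Main.v *)
(* If Y is bounded by M and c >= 2M, then |X|^p 1_{|X| > c} <= (2|X - Y|)^p
   pointwise, so the tail of X is controlled, uniformly in P, by the distance
   from X to Y. Conversely, for the truncation Y = X 1_{|X| <= n}, the moment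
   of X - Y is exactly the tail of X. *)
Require Import Defs.
From HB Require Import structures.
From mathcomp Require Import all_boot all_order all_algebra generic_quotient.
From mathcomp Require Import all_classical all_reals all_analysis.
From mathcomp Require Import measurable_realfun.

Import Order.TTheory GRing.Theory Num.Theory.
Import numFieldNormedType.Exports.

Local Open Scope classical_set_scope.
Local Open Scope ring_scope.

(** A real upper bound on a nonnegative term already makes it finite, so no finiteness of [u] has to
    be assumed beforehand. *)
Lemma ge0_cvge0P (R : realType) (u : (\bar R)^nat) :
  (forall n, 0 <= u n)%E ->
  u n @[n --> \oo] --> (0 : \bar R)%E <->
  (forall e : R, 0 < e -> \forall n \near \oo, (u n < e%:E)%E).
Proof.
move=> u0; split=> [u_cvg e e0|u_lt].
  have /fine_cvgP[u_fin /cvgr0Pnorm_lt/(_ e e0) ue] := u_cvg.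
  near=> n.
  have un : u n \is a fin_num by near: n.
  rewrite -(fineK un) lte_fin (le_lt_trans (ler_norm _))//.
  by near: n.
apply/fine_cvgP; split.
  near=> n; rewrite ge0_fin_numE// (@lt_trans _ _ 1%:E) ?ltry//.
  by near: n; exact: u_lt.
apply/cvgr0Pnorm_lt => e e0; near=> n.
have une : (u n < e%:E)%E by near: n; exact: u_lt.
rewrite /= ger0_norm ?fine_ge0// -lte_fin fineK//.
by rewrite ge0_fin_numE// (lt_trans une) ?ltry.
Unshelve. all: by end_near. Qed.

Section truncation.
Local Open Scope quotient_scope.
Context d (T : measurableType d) (R : realType).
Variables (PP : set (probability T R)) (PP0 : PP !=set0).
Variables (p : R) (p0 : 0 < p).

Lemma le_upper_expectation (f g : T -> R) :
  measurable_fun setT f -> measurable_fun setT g ->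
  (forall w, 0 <= f w) -> (forall w, f w <= g w) ->
  (upper_expectation PP f <= upper_expectation PP g)%E.
Proof.
move=> mf mg f0 fg; apply: ge_ereal_sup => _ [P PPP <-].
apply: (@le_trans _ _ ('E_P[g])%E); last by apply: ereal_sup_ubound; exists P.
rewrite unlock; apply: ge0_le_integral => //.
- by move=> w _; rewrite lee_fin.
- exact/measurable_EFinP.
- exact/measurable_EFinP.
- by move=> w _; rewrite lee_fin.
Qed.

Lemma size_p_lt (X : T -> R) (e : R) : 0 < e -> (moment PP p X < +oo)%E ->
  (size_p PP p X < e) =
  (moment PP p X < (if 1 <= p then e `^ p else e)%:E)%E.
Proof.
move=> e0 Xoo; rewrite /size_p [in RHS](moment_fineK PP0 Xoo) lte_fin.
case: ifP => // _.
have m0 : 0 <= fine (moment PP p X) by exact/fine_ge0/moment_ge0.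
have eE : e = (e `^ p) `^ p^-1 by rewrite -powRrM mulfV ?gt_eqF// powRr1 ?ltW.
have ip0 : 0 < p^-1 by rewrite invr_gt0.
rewrite {1}eE; apply: (leW_mono_in (le_mono_in (gt0_ltr_powR ip0))) => //.
by rewrite nnegrE powR_ge0.
Qed.

Lemma measurable_gt_norm (X : T -> R) (c : R) : measurable_fun setT X ->
  measurable [set w | c < `|X w|].
Proof.
move=> mX; rewrite -[X in measurable X]setTI.
have mnX : measurable_fun setT (fun w => `|X w|) by exact: measurableT_comp.
have := mnX measurableT `]c, +oo[%classic (measurable_itv _).
by congr measurable; apply/seteqP; split => w /=; rewrite in_itv/= andbT.
Qed.

Definition tail_moment (X : T -> R) (c : R) : \bar R :=
  upper_expectation PP (fun w => `|X w| `^ p * \1_[set w' | c < `|X w'|] w).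

Lemma measurable_tail (X : T -> R) (c : R) : measurable_fun setT X ->
  measurable_fun setT (fun w => `|X w| `^ p * \1_[set w' | c < `|X w'|] w).
Proof.
move=> mX; apply: measurable_funM; first exact: measurable_absp.
exact/measurable_indic/measurable_gt_norm.
Qed.

Lemma tail_moment_ge0 X c : (0 <= tail_moment X c)%E.
Proof. by apply: upper_expectation_ge0 => // w; rewrite mulr_ge0 ?powR_ge0. Qed.

(** Where |X| > c, the bound 2|Y| <= 2M <= c < |X| gives |X| <= 2|X - Y|. The double is written as a
    sum so that [size_pD] applies to it directly, whatever [p]. *)
Lemma tail_moment_le (X Y : T -> R) (M c : R) :
  measurable_fun setT X -> measurable_fun setT Y ->
  (forall w, `|Y w| <= M) -> M *+ 2 <= c ->
  (tail_moment X c <= moment PP p ((X \- Y) \+ (X \- Y))%R)%E.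
Proof.
move=> mX mY YM Mc; have mXY := measurable_funB mX mY.
apply: le_upper_expectation; first exact: measurable_tail.
- by apply: measurable_absp; exact: measurable_funD.
- by move=> w; rewrite mulr_ge0 ?powR_ge0.
move=> w; rewrite indicE; case: (boolP (w \in _)) => [|_]; last first.
  by rewrite mulr0 powR_ge0.
rewrite inE/= mulr1 => cX.
apply: ge0_ler_powR; rewrite ?nnegrE//; first exact: ltW.
rewrite -mulr2n normrMn.
have XY : `|X w| - `|Y w| <= `|X w - Y w| by exact: lerB_dist.
apply: le_trans (_ : (`|X w| - `|Y w|) *+ 2 <= _); last by rewrite lerMn2r.
(* 2(|X| - |Y|) = |X| + (|X| - 2|Y|), so it remains to see that 2|Y| <= |X|. *)
rewrite mulrnBl mulr2n -addrA lerDl subr_ge0.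
by rewrite (le_trans _ (ltW cX))// (le_trans _ Mc)// lerMn2r YM.
Qed.

(** Large values are replaced by 0 rather than clipped to c or -c, so that what is removed from [X]
    is exactly its tail. *)
Definition truncation (X : T -> R) (c : R) : T -> R :=
  fun w => X w * \1_(~` [set w' | c < `|X w'|]) w.

Lemma measurable_truncation (X : T -> R) c : measurable_fun setT X ->
  measurable_fun setT (truncation X c).
Proof.
move=> mX; apply: measurable_funM => //.
exact/measurable_indic/measurableC/measurable_gt_norm.
Qed.

Lemma bounded_truncation X c : bounded_fun (truncation X c).
Proof.
(* [c] may be negative, in which case the truncation vanishes identically. *)
exists `|c|; split; first exact: normr_real.
move=> M cM w _; rewrite /truncation /= indicE.
have M0 : 0 <= M by rewrite (le_trans _ (ltW cM)).
case: (boolP (w \in _)) => [|_]; last by rewrite mulr0 normr0.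
rewrite inE/= mulr1 => /negP; rewrite -leNgt => /le_trans; apply.
by rewrite (le_trans (ler_norm _))// ltW.
Qed.

Lemma moment_truncation X c :
  moment PP p (X \- truncation X c) = tail_moment X c.
Proof.
congr upper_expectation; apply/funext => w.
rewrite /truncation /= !indicE in_setC.
case: (w \in _) => /=; rewrite ?(mulr0, mulr1, subr0)//.
by rewrite subrr normr0 powR0 ?gt_eqF.
Qed.

Lemma LpbE : Lpb PP0 p0 =
  [set X : Lp PP0 p0 | tail_moment X n%:R @[n --> \oo] --> (0 : \bar R)%E].
Proof.
(* The distance to a class can be computed with any chosen representative [Y], in particular with a
   bounded one. *)
have dist_pi (X : Lp PP0 p0) (Y : preLp PP p) :
    Lp_dist X (\pi_(Lp PP0 p0) Y) = size_p PP p (X \- mfun_of_preLp Y).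
  by rewrite -(Lp_dist_pi PP0 p0 (repr X) Y) reprK.
have mX (X : Lp PP0 p0) : measurable_fun setT X by exact: measurable_funPT.
apply/seteqP; split => X /=.
  move=> /LpbP XB; apply/ge0_cvge0P => [n|e e0]; first exact: tail_moment_ge0.
  (* Chosen so that size below [r] means moment below [e]. The approximation is taken within [r / 2]
     because the difference gets doubled in [tail_moment_le]. *)
  pose r : R := if 1 <= p then e `^ p^-1 else e.
  have r0 : 0 < r by rewrite /r; case: ifP => // _; exact: powR_gt0.
  have rE : (if 1 <= p then r `^ p else r) = e.
    rewrite /r; case: (1 <= p) => //.
    by rewrite -powRrM mulVf ?gt_eqF// powRr1 ?ltW.
  have [_ [Y /= [M [_ YM]] <-]] := XB (r / 2) (divr_gt0 r0 (ltr0n _ 2)).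
  rewrite dist_pi => XY.
  (* [bounded_fun] only provides the bounds strictly above [M], and [M] may be negative. *)
  pose M1 := `|M| + 1.
  have {}YM w : `|mfun_of_preLp Y w| <= M1.
    by apply: YM => //; rewrite (le_lt_trans (ler_norm _))// ltrDl.
  have mY := measurable_preLp Y.
  have mXY := measurable_funB (mX X) mY.
  have XYoo : (moment PP p (X \- mfun_of_preLp Y)%R < +oo)%E.
    by apply: momentB_lty => //; [exact: moment_Lp|exact: moment_preLp].
  have lt_e : (moment PP p ((X \- mfun_of_preLp Y) \+ (X \- mfun_of_preLp Y))%R
      < e%:E)%E.
    rewrite -rE -size_p_lt//; last exact: momentD_lty.
    apply: le_lt_trans (size_pD PP0 p0 mXY mXY XYoo XYoo) _.
    by rewrite [ltRHS]splitr ltrD.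
  near=> n; apply: le_lt_trans lt_e.
  (* Every n >= 2 [M1] works. *)
  apply: (tail_moment_le _ (mfun_of_preLp Y) M1) => //.
  by near: n; exact: nbhs_infty_ger.
move=> /ge0_cvge0P X0; apply/LpbP => e e0.
have {}X0 := X0 (fun n => tail_moment_ge0 X n%:R).
have q0 : 0 < (if 1 <= p then e `^ p else e).
  by case: ifP => // _; exact: powR_gt0.
(* A single level [n] with a small enough tail suffices: the truncation there is the bounded
   approximation sought. *)
have [n _ /(_ n (leqnn n)) Xn] := X0 _ q0.
have mt := measurable_truncation X n%:R (mX X).
pose t := mfun_Sub (mem_set mt : truncation X n%:R \in mfun).
have bt : bounded_fun t by exact: bounded_truncation.
have too : (moment PP p t < +oo)%E by exact: moment_bounded_fun.
exists (\pi_(Lp PP0 p0) (exist _ t too : preLp PP p)).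
  by exists (exist _ t too).
rewrite dist_pi /= size_p_lt//.
  by rewrite moment_truncation.
by apply: momentB_lty => //; exact: moment_Lp.
Unshelve. all: by end_near. Qed.

End truncation.

Theorem proposition18 (R : realType) (Omega : completeMetricType R)
    (Omega_separable : separable Omega)
    (PP : set (probability (borel Omega) R)) (PP0 : PP !=set0)
    (p : R) (p0 : 0 < p) :
  Lpb PP0 p0 =
  [set X : Lp PP0 p0 |
     upper_expectation PP
       (fun w => `|X w| `^ p * \1_[set w' | n%:R < `|X w'|] w)
     @[n --> \oo] --> (0 : \bar R)%E].
Proof. exact: LpbE. Qed.
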